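(* Let $\phi$ be a $\mathsf c$-convex potential of $\mathsf c$-Legendre type of the cost $\mathsf c(x,\bar x)$ on $\mathcal N\subset\Omega\times\bar\Omega\subset\mathbb R^n\times\mathbb R^n$, with optimal map $\mathbf T=\mathbf T_\phi$ (write $x_{\mathbf T}=\mathbf T(x)$). Assume that $$\hat{\mathcal N}=\{(x,x')\in\Omega\times\Omega:\ (x,x'_{\mathbf T})\in\mathcal N\}$$ is an open subset of $\mathbb R^n\times\mathbb R^n$. Equip $\hat{\mathcal N}$ with the Kim-McCann metric $KM_{\mathfrak D}$ of the cost $\mathfrak D$, the $\mathsf c$-divergence $\mathfrak D[x:x']=\mathsf c(x,x'_{\mathbf T})+\phi(x)-\mathsf c(x',x'_{\mathbf T})-\phi(x')$. Then for a tangent vector $\hat\xi=(\xi,\xi')$ of $\hat{\mathcal N}$ at $(x,x')$, $$\langle\hat\xi,\hat\xi\rangle_{KM_{\mathfrak D}}=-\big(\bar D_{d\mathbf T(x')\xi'}D_\xi\mathsf c\big)(x,x'_{\mathbf T}),$$ where $d\mathbf T$ is the differential of $\mathbf T$, given by the implicit function theorem: $$\mathrm{hess}^{\mathsf c}_\phi(x')\xi'+\big(\bar D_{d\mathbf T(x')\xi'}\mathcal D\mathsf c\big)(x',x'_{\mathbf T})=0,\qquad d\mathbf T(x')\xi'=-\big(\bar D\mathcal D\mathsf c(x',x'_{\mathbf T})\big)^{-1}\mathrm{hess}^{\mathsf c}_\phi(x')\xi'.$$ The restriction of $KM_{\mathfrak D}$ to the diagonal $(x,x)\in\hat{\mathcal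 N}$, $x\in\Omega$, is the divergence metric of $\mathfrak D$, given by $\mathrm{hess}^{\mathsf c}_\phi$. Moreover the $\mathsf c$-Crouzeix identity holds: $$d\mathbf T_\phi(x)\;d\mathbf T^{\bar{\mathsf c}}_{\phi^{\bar{\mathsf c}}}(x_{\mathbf T})=I_{\bar\Omega},$$ $$\Big((\bar D\mathcal D\mathsf c)^{-1}\,\mathrm{hess}^{\mathsf c}_\phi\,(D\bar{\mathcal D}\mathsf c)^{-1}\,\mathrm{hess}^{\bar{\mathsf c}}_{\phi^{\bar{\mathsf c}}}\Big)_{x,x_{\mathbf T}}=I_{\bar\Omega},$$ where $I_{\bar\Omega}$ is the identity of the tangent space of $\bar\Omega$.
   Context: $\Omega,\bar\Omega\subset\mathbb R^n$ are domains. $D,\bar D$ are directional derivatives and $\mathcal D,\bar{\mathcal D}$ gradients (for the standard inner product) in the first and second variable of the cost $\mathsf c$; $\bar D\mathcal D\mathsf c$ is the linear operator $\bar\omega\mapsto\bar D_{\bar\omega}\mathcal D\mathsf c$ and $D\bar{\mathcal D}\mathsf c$ the operator $\omega\mapsto D_\omega\bar{\mathcal D}\mathsf c$. The cost is sufficiently smooth and satisfies: (A1) for each $x$, $\bar x\mapsto-D\mathsf c(x,\bar x)$ (the differential in $x$) is injective on $\{\bar x:(x,\bar x)\in\mathcal N\}$; (A2) the bilinear pairing $(\xi,\bar\xi)\mapsto\bar D_{\bar\xi}D_\xi\mathsf c$ is nondegenerate. The Kim-McCann metric of a cost is $\langle(\omega_1,\bar\omega_1),(\omega_2,\bar\omega_2)\rangle_{KM}=-\frac12(D_{\omega_1}\bar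 D_{\bar\omega_2}\mathsf c+\bar D_{\bar\omega_1}D_{\omega_2}\mathsf c)$; for $\mathfrak D$ the two variables are $x,x'$. Transforms: $\phi^{\bar{\mathsf c}}(\bar x)=\sup_x(-\mathsf c(x,\bar x)-\phi(x))$, $\psi^{\mathsf c}(x)=\sup_{\bar x}(-\mathsf c(x,\bar x)-\psi(\bar x))$; $\phi$ is $\mathsf c$-convex if $\phi=\psi^{\mathsf c}$ for some $\psi$, equivalently $\phi^{\bar{\mathsf c}\mathsf c}=\phi$. For $\mathsf c$-convex $\phi$ such that for each $\bar x\in\bar\Omega$ the maximum of $x\mapsto-\mathsf c(x,\bar x)-\phi(x)$ is attained at a unique interior point of $\Omega$, the optimal map $\mathbf T_\phi$ is the inverse (assumed well defined) of the map sending $\bar x$ to that point. It satisfies $\mathcal D\mathsf c(x,x_{\mathbf T})+\mathrm{grad}_\phi(x)=0$. The $\mathsf c$-Hessian is $\mathrm{hess}^{\mathsf c}_\phi(x)\xi=(D_\xi\mathcal D\mathsf c)(x,x_{\mathbf T})+\mathrm{hess}_\phi(x)\xi$ ($x_{\mathbf T}$ held fixed in $D_\xi$). $\phi$ is of $\mathsf c$-Legendre type if $\mathbf T_\phi$ is a diffeomorphism between $\Omega$ and $\bar\Omega$ and $\mathrm{hess}^{\mathsf c}_\phi(x)$ is positive definite. $\mathbf T^{\bar{\mathsf c}}_{\phi^{\bar{\mathsf c}}}$ is the optimal map for the cost $\bar{\mathsf c}(\bar x,x)=\mathsf c(x,\bar x)$ and potential $\phi^{\bar{\mathsf c}}$,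 and $\mathrm{hess}^{\bar{\mathsf c}}_{\phi^{\bar{\mathsf c}}}(\bar x)\bar\xi=(\bar D_{\bar\xi}\bar{\mathcal D}\mathsf c)(x,\bar x)+\mathrm{hess}_{\phi^{\bar{\mathsf c}}}(\bar x)\bar\xi$ with $\bar x=x_{\mathbf T}$. The divergence metric of $\mathfrak D$ is the symmetric operator $G$ with $\xi^{\mathsf T}G\xi=-(D'_\xi D_\xi\mathfrak D)|_{x'=x}$, $D'$ being the derivative in $x'$. *)

(* Defs.v *)
From HB Require Import structures.
From mathcomp Require Import all_boot all_order all_algebra.
From mathcomp Require Import all_classical all_reals all_analysis.

Set Implicit Arguments.
Unset Strict Implicit.
Unset Printing Implicit Defensive.

Import Order.TTheory GRing.Theory Num.Theory.
Import numFieldNormedType.Exports.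

Local Open Scope classical_set_scope.
Local Open Scope ring_scope.

(* R^n is 'cV[R]_n.  Every function is total; its values outside the open set
   on which it is meant to be defined play no role. *)

Section Regularity.
Context {R : realType} {V W : normedModType R}.

(* Of class C^k at every point of A (A is open in all uses). *)
Fixpoint of_class (k : nat) (A : set V) (f : V -> W) : Prop :=
  match k with
  | 0%N => {in A, continuous f}
  | k'.+1 => (forall x, A x -> differentiable f x) /\
             (forall v, of_class k' A ('D_v f))
  end.

Definition domain (A : set V) : Prop := [/\ open A, connected A & A !=set0].

End Regularity.

Definition diffeomorphism {R : realType} {V W : normedModType R}
    (A : set V) (B : set W) (f : V -> W) : Prop :=
  exists g : W -> V,
    [/\ forall x, A x -> B (f x) /\ g (f x) = x,
        forall y, B y -> A (g y) /\ f (g y) = y,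
        of_class 1 A f & of_class 1 B g].

Section Cost.
Context {R : realType} {n : nat}.
Local Notation E := 'cV[R]_n.

Definition dot (u v : E) : R := (u^T *m v) 0 0.

Definition grad (f : E -> R) (x : E) : E := \col_i 'D_(delta_mx i 0) f x.

Definition hess (f : E -> R) (x xi : E) : E := 'D_xi (grad f) x.

(* The cost c is a function on N; cobar c, on transpose N, is the same cost
   with its two variables exchanged. *)
Definition cobar (c : E -> E -> R) : E -> E -> R := fun xb x => c x xb.
Definition transpose (N : set (E * E)) : set (E * E) :=
  [set p | N (p.2, p.1)].

Definition D_Dbar (c : E -> E -> R) (x xb w wb : E) : R :=
  'D_w (fun y => 'D_wb (c y) xb) x.
Definition Dbar_D (c : E -> E -> R) (x xb w wb : E) : R :=
  'D_wb (fun yb => 'D_w (c ^~ yb) x) xb.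

(* The operator wb |-> Dbar_wb (gradient of c in its first variable).  The
   operator w |-> D_w (gradient of c in its second variable) at (x, xb) is
   Dbar_grad (cobar c) xb x. *)
Definition Dbar_grad (c : E -> E -> R) (x xb wb : E) : E :=
  'D_wb (fun yb => grad (c ^~ yb) x) xb.

(* Inverse of an operator, meaningful when f is bijective. *)
Definition operator_inv (f : E -> E) : E -> E := 'pinv_(fun=> 0) setT f.

Definition twisted (N : set (E * E)) (c : E -> E -> R) : Prop :=
  forall x, set_inj [set xb | N (x, xb)] (fun xb w => - 'D_w (c ^~ xb) x).

Definition nondegenerate_pairing (N : set (E * E)) (c : E -> E -> R) : Prop :=
  forall x xb, N (x, xb) ->
    (forall xi, (forall xib, Dbar_D c x xb xi xib = 0) -> xi = 0) /\
    (forall xib, (forall xi, Dbar_D c x xb xi xib = 0) -> xib = 0).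

Definition kim_mccann (c : E -> E -> R) (x xb : E) (w1 w2 : E * E) : R :=
  - 2^-1 * (D_Dbar c x xb w1.1 w2.2 + Dbar_D c x xb w2.1 w1.2).

(* phi |-> phi^cbar, a supremum over the first variable.  The transform
   psi |-> psi^c is ctransform (transpose N) (cobar c). *)
Definition ctransform (N : set (E * E)) (c : E -> E -> R)
    (phi : E -> \bar R) (xb : E) : \bar R :=
  ereal_sup [set ((- c x xb)%:E - phi x)%E | x in [set x | N (x, xb)]].

Definition cconvex (Omega : set E) (N : set (E * E)) (c : E -> E -> R)
    (phi : E -> R) : Prop :=
  exists psi : E -> \bar R, forall x, Omega x ->
    (phi x)%:E = ctransform (transpose N) (cobar c) psi x.

(* phi^cbar as a real-valued potential (fine sends +oo and -oo to 0; under
   optimal_map_defined the supremum is a maximum, hence finite). *)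
Definition conjugate (N : set (E * E)) (c : E -> E -> R) (phi : E -> R) :
    E -> R :=
  fun xb => fine (ctransform N c (EFin \o phi) xb).

Definition maximizers (N : set (E * E)) (c : E -> E -> R) (phi : E -> R)
    (xb : E) : set E :=
  [set x | N (x, xb) /\
     forall y, N (y, xb) -> - c y xb - phi y <= - c x xb - phi x].

Definition maximizer (N : set (E * E)) (c : E -> E -> R) (phi : E -> R)
    (xb : E) : E := xget 0 (maximizers N c phi xb).

Definition optimal_map (Omegab : set E) (N : set (E * E)) (c : E -> E -> R)
    (phi : E -> R) : E -> E :=
  'pinv_(fun=> 0) Omegab (maximizer N c phi).

Definition optimal_map_defined (Omega Omegab : set E) (N : set (E * E))
    (c : E -> E -> R) (phi : E -> R) : Prop :=
  (forall xb, Omegab xb ->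
     exists2 x, Omega° x & maximizers N c phi xb = [set x]) /\
  set_bij Omegab Omega (maximizer N c phi).

(* The c-Hessian of phi at x when xb is the image of x by the optimal map. *)
Definition chess (c : E -> E -> R) (phi : E -> R) (x xb xi : E) : E :=
  'D_xi (grad (c ^~ xb)) x + hess phi x xi.

Definition clegendre (Omega Omegab : set E) (N : set (E * E))
    (c : E -> E -> R) (phi : E -> R) : Prop :=
  let T := optimal_map Omegab N c phi in
  diffeomorphism Omega Omegab T /\
  forall x, Omega x -> forall xi, xi != 0 ->
    0 < dot xi (chess c phi x (T x) xi).

Definition cdivergence (c : E -> E -> R) (phi : E -> R) (T : E -> E)
    (x x' : E) : R :=
  c x (T x') + phi x - c x' (T x') - phi x'.

Definition divergence_metric (D : E -> E -> R) (x : E) (G : E -> E) : Prop :=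
  [/\ linear G, forall u v, dot (G u) v = dot u (G v) &
      forall xi, dot xi (G xi) = - Dbar_D D x x xi xi].

End Cost.

(* Main.v *)
Require Import Defs.
From HB Require Import structures.
From mathcomp Require Import all_boot all_order all_algebra.
From mathcomp Require Import all_classical all_reals all_analysis.
From mathcomp Require Import ring lra.
Import Order.TTheory GRing.Theory Num.Theory.
Import numFieldNormedType.Exports.
Local Open Scope classical_set_scope.
Local Open Scope ring_scope.

(** A maximizer condition alone gives the regularity of [phi].  With [C p] the
cost [c p.1 p.2], maximality at [x] for [T x] and at [y] for [T y] squeezes
[phi y - phi x] between [c x (T x) - c y (T x)] and [c x (T y) - c y (T y)], so
by the mean value theorem [phi] has directional derivatives
[- 'D_(v, 0) C (x, T x)] on [Omega].  These are differentiable because [T] is,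
and differentiating them once more gives [chess xi = - Dbar_grad ('d T xi)].
The symmetry of the c-Hessian and of the mixed derivatives of [c] is Schwarz'
theorem.  The conjugate [phib] is an optimal potential for the exchanged cost
with optimal map the inverse of [T], so the same formula applies to it, and the
c-Crouzeix identity is the chain rule for [T \o Tb = id]. *)

Set Implicit Arguments.
Unset Strict Implicit.

(** * Directional derivatives and Schwarz' theorem *)

Section Calculus.
Context {R : realType}.
Implicit Types U V W : normedModType R.

(** The difference quotient of the restriction at [t] is literally that of [f] at [x + t *: v], so
    derivability along [v] suffices and no chain rule enters. *)
Lemma is_derive_line V W (f : V -> W) (x v : V) (t : R) :
  derivable f (x + t *: v) v ->
  is_derive t 1 (fun s : R => f (x + s *: v)) ('D_v f (x + t *: v)).
Proof.
suff E : (fun h : R => h^-1 *: (((fun s : R => f (x + s *: v)) \o shift t)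
    (h *: (1 : R^o)) - f (x + t *: v))) =
  (fun h : R => h^-1 *: ((f \o shift (x + t *: v)) (h *: v) - f (x + t *: v))).
  by move=> df; apply: DeriveDef; rewrite /derivable /derive E.
apply/funext => h /=; congr (_ *: (f _ - _)).
by rewrite [h *: 1]mulr1 scalerDl addrCA.
Qed.

(** Locating the mean point by [|t| <= |s|] instead of an interval covers both signs of [s]; the
    proof applies the one-variable theorem on [[0, s]] or [[s, 0]]. *)
Lemma mvt_line V (f : V -> R) (x v : V) (s : R) :
  (forall t, `|t| <= `|s| -> derivable f (x + t *: v) v) ->
  exists2 t, `|t| <= `|s| & f (x + s *: v) - f x = s * 'D_v f (x + t *: v).
Proof.
move=> df; pose g t := f (x + t *: v).
have cg (a b : R) : (forall t, a <= t <= b -> `|t| <= `|s|) -> a <= b ->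
    exists2 t, `|t| <= `|s| & g b - g a = 'D_v f (x + t *: v) * (b - a).
  move=> ab leab.
  have dg t : t \in `[a, b] -> is_derive t 1 g ('D_v f (x + t *: v)).
    by rewrite in_itv/= => /ab/df; exact: is_derive_line.
  have dg' t : t \in `]a, b[ -> is_derive t 1 g ('D_v f (x + t *: v)).
    by move=> /subset_itv_oo_cc/dg.
  have gc : {within `[a, b], continuous g}.
    by apply: derivable_within_continuous => t /dg[].
  have [t tab e] := MVT_segment leab dg' gc.
  by exists t => //; apply: ab; rewrite in_itv/= in tab.
have g0 : g 0 = f x by rewrite /g scale0r addr0.
have [s0|/ltW s0] := leP 0 s.
- have [|//|t ts] := cg 0 s.
    by move=> t /andP[t0 ts]; rewrite !ger0_norm.
  by rewrite g0 subr0 mulrC => e; exists t.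
- have [|//|t ts] := cg s 0.
    by move=> t /andP[ts t0]; rewrite !ler0_norm// lerN2.
  rewrite g0 sub0r mulrN => e; exists t => //.
  by rewrite mulrC -[RHS]opprK -e opprB.
Qed.

Lemma near_ball0 V (p : V) (P : V -> Prop) :
  (\forall q \near p, P q) ->
  exists2 d : R, 0 < d & forall k, `|k| < d -> P (p + k).
Proof. by move=> /nbhs0P/nbhs_norm0P[d d0 dP]; exists d. Qed.

Lemma derivable_translate V W (f : V -> W) (x w v : V) :
  derivable f (x + w) v -> is_derive x v (fun y => f (y + w)) ('D_v f (x + w)).
Proof.
have E : (fun h : R => h^-1 *: (((fun y => f (y + w)) \o shift x) (h *: v)
    - f (x + w))) =
  (fun h : R => h^-1 *: ((f \o shift (x + w)) (h *: v) - f (x + w))).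
  by apply/funext => h /=; rewrite addrA.
by move=> df; apply: DeriveDef; rewrite /derivable /derive E.
Qed.

Lemma differentiable_approx V W (f : V -> W) (p : V) (e : R) :
  differentiable f p -> 0 < e ->
  \forall k \near (0 : V), `|f (p + k) - f p - 'd f p k| <= e * `|k|.
Proof.
move=> df e0; have /diff_locally/eqaddoP/(_ _ e0) := df.
by apply: filterS => k; rewrite !fctE/= (addrC k) opprD addrA.
Qed.

(** The second difference is the increment along [s *: a] of [y |-> f (y + s *: b) - f y]. The mean
    value theorem turns it into [s] times a difference of two values of ['D_a f], and
    differentiability of ['D_a f] at [p] evaluates each of them up to [o(s)]. *)
Lemma second_difference V (f : V -> R) (p a b : V) (e : R) :
  (\forall q \near p, derivable f q a) -> differentiable ('D_a f) p -> 0 < e ->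
  \forall s \near (0 : R),
    `|f (p + s *: a + s *: b) - f (p + s *: a) - f (p + s *: b) + f p
      - s ^+ 2 * 'D_b ('D_a f) p| <= e * s ^+ 2.
Proof.
(* Both displacements [t *: a] and [t *: a + s *: b] have norm at most [|s| * M]; the tolerance
   [e / (2 * M)] then leaves an error [e / 2 * |s|] for each. *)
move=> da dda e0; pose M := `|a| + `|b| + 1.
have M0 : 0 < M by rewrite ltr_pwDr// addr_ge0.
have e'0 : 0 < e / (2 * M) by rewrite divr_gt0// mulr_gt0.
have /near_ball0[d1 d10 d1P] := da.
have /nbhs_norm0P[d2 d20 d2P] := differentiable_approx dda e'0.
pose d := Num.min d1 d2; have d0 : 0 < d by rewrite lt_min d10.
apply/nbhs_norm0P; exists (d / M) => [/=|s /=]; first by rewrite divr_gt0.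
rewrite ltr_pdivlMr// => sM.
have bnd k : `|k| <= `|s| * M ->
    derivable f (p + k) a /\
    `|'D_a f (p + k) - 'D_a f p - 'd ('D_a f) p k| <= e / 2 * `|s|.
  move=> kM; have kd : `|k| < d by rewrite (le_lt_trans kM).
  split; first by apply: d1P; rewrite (lt_le_trans kd)// ge_min lexx.
  have /d2P/le_trans : `|k| < d2 by rewrite (lt_le_trans kd)// ge_min lexx orbT.
  apply; rewrite (le_trans (ler_wpM2l (ltW e'0) kM))//.
  by have -> : e / (2 * M) * (`|s| * M) = e / 2 * `|s| by field; rewrite gt_eqF.
have le1 t : `|t| <= `|s| -> `|t *: a| <= `|s| * M.
  move=> ts; rewrite normrZ ler_pM//.
  by rewrite /M -addrA lerDl addr_ge0.
have le2 t : `|t| <= `|s| -> `|t *: a + s *: b| <= `|s| * M.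
  move=> ts; rewrite (le_trans (ler_normD _ _))// !normrZ.
  rewrite /M !mulrDr mulr1 -[leLHS]addr0 lerD// lerD2r ler_wpM2r//.
have dF t : `|t| <= `|s| -> is_derive (p + t *: a) a
    (fun y => f (y + s *: b) - f y)
    ('D_a f (p + t *: a + s *: b) - 'D_a f (p + t *: a)).
  move=> ts; apply: is_deriveB.
    by apply: derivable_translate; rewrite -addrA; case: (bnd _ (le2 _ ts)).
  by apply: DeriveDef => //; case: (bnd _ (le1 _ ts)).
have [t ts] : exists2 t, `|t| <= `|s| & _ :=
  mvt_line (fun t ts => @ex_derive _ _ _ _ _ _ _ (dF t ts)).
rewrite (@derive_val _ _ _ _ _ _ _ (dF t ts)) => E.
have -> : f (p + s *: a + s *: b) - f (p + s *: a) - f (p + s *: b) + f p =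
    f (p + s *: a + s *: b) - f (p + s *: a) - (f (p + s *: b) - f p).
  by rewrite opprB -addrA; congr (_ + _); rewrite addrC.
rewrite E (deriveE _ dda).
have [_ b1] := bnd _ (le1 _ ts); have [_ b2] := bnd _ (le2 _ ts).
(* The linear parts at [t *: a + s *: b] and at [t *: a] differ by [s] times the differential at
   [b], so the unknown mean point [t] drops out. *)
have -> : s * ('D_a f (p + t *: a + s *: b) - 'D_a f (p + t *: a)) -
    s ^+ 2 * 'd ('D_a f) p b =
  s * (('D_a f (p + (t *: a + s *: b)) - 'D_a f p
        - 'd ('D_a f) p (t *: a + s *: b))
      - ('D_a f (p + t *: a) - 'D_a f p - 'd ('D_a f) p (t *: a))).
  rewrite linearD linearZ/= [in RHS]linearZ/= addrA.
  rewrite [in RHS]linearZ/=.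
  set u := 'D_a f _; set v := 'D_a f (p + _); set w := 'd _ _ b.
  by rewrite -![_ *: _]/(_ * _); ring.
rewrite normrM -(real_normK (num_real s)) expr2 mulrA [leRHS]mulrC.
rewrite ler_wpM2l// (le_trans (ler_normB _ _))//.
by rewrite [e]splitr mulrDl lerD.
Qed.

(** Used with [x] a second difference and [t = s ^+ 2], to compare its two leading coefficients. *)
Lemma close_coefficients (x u v e t : R) : 0 < t ->
  `|x - t * u| <= e / 2 * t -> `|x - t * v| <= e / 2 * t -> `|u - v| <= e.
Proof.
move=> t0 hu hv; rewrite -(ler_pM2r t0) -[X in _ * X](gtr0_norm t0) -normrM.
have -> : (u - v) * t = (x - t * v) - (x - t * u) by ring.
by rewrite (le_trans (ler_normB _ _))// [e]splitr mulrDl lerD.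
Qed.

(** The second difference is symmetric in [a] and [b], and is [s ^+ 2] times either iterated
    derivative up to [o(s ^+ 2)]. *)
Lemma schwarz V (f : V -> R) (p a b : V) :
  (\forall q \near p, derivable f q a) -> (\forall q \near p, derivable f q b) ->
  differentiable ('D_a f) p -> differentiable ('D_b f) p ->
  'D_b ('D_a f) p = 'D_a ('D_b f) p.
Proof.
move=> da db dda ddb; apply/eqP; rewrite -subr_eq0 -normr_le0.
apply/ler_addgt0Pr => e e0; rewrite add0r.
have e2 : 0 < e / 2 by rewrite divr_gt0.
have [d /= d0 dP] := (@nbhs_norm0P _ _ _).1
  (filterI (second_difference b da dda e2) (second_difference a db ddb e2)).
(* A single nonzero [s] in the common neighbourhood is enough for the given [e]. *)
have [|] := dP (d / 2).
  rewrite /= ger0_norm ?ltr_pdivrMr ?ltr_pMr ?ltr1n//.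
  by rewrite divr_ge0// ltW.
have : 0 < d / 2 by rewrite divr_gt0.
move: (d / 2) => s s0; move=> h1 h2; apply: (@close_coefficients _ _ _ _ (s ^+ 2)) h1 _.
  by rewrite exprn_gt0.
by rewrite [p + s *: a + _]addrAC addrAC -[X in X + f p - _]addrAC in h2 *; exact: h2.
Qed.

(** * Chain rule, locally equal functions and partial derivatives on a product *)

Lemma derive_comp U V W (g : U -> V) (f : V -> W) (x v : U) :
  differentiable g x -> differentiable f (g x) ->
  'D_v (fun y => f (g y)) x = 'D_('D_v g x) f (g x).
Proof.
move=> dg df; have dfg := differentiable_comp dg df.
by rewrite (deriveE _ df) (deriveE v dg) (deriveE v dfg) (diff_comp dg df).
Qed.

(** The first-order expansion of [f] at [x] is also one of [g]; uniqueness of the differential gives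
    the second claim. *)
Lemma near_eq_diff V W (f g : V -> W) (x : V) :
  (\forall y \near x, f y = g y) -> differentiable f x ->
  differentiable g x /\ 'd g x = 'd f x :> (V -> W).
Proof.
move=> fg df; have dE : g \o shift x = cst (g x) + 'd f x +o_ 0 id.
  apply/eqaddoP => e e0; have /diff_locally/eqaddoP/(_ _ e0) := df.
  have fgx := nbhs_singleton fg; have /nbhs0P fg0 := fg.
  apply: filterS2 fg0 => k fgk.
  by rewrite !fctE/= (addrC k) fgk fgx.
have dg : 'd g x = 'd f x :> (V -> W).
  by apply: diff_unique => //; exact: diff_continuous.
by split => //; apply/diff_locallyP; rewrite dg; split => //; exact: diff_continuous.
Qed.

(** Chain rule for [f \o g], which is the identity near [y]. A local hypothesis is the right one for
    maps inverse to each other on open sets only. *)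
Lemma diff_right_inverse V W (f : V -> W) (g : W -> V) (x : V) (y v : W) :
  g y = x -> differentiable f x -> differentiable g y ->
  (\forall z \near y, f (g z) = z) -> 'd f x ('d g y v) = v.
Proof.
move=> <- df dg fgK; have did : differentiable id y by [].
have idE : \forall z \near y, id z = (f \o g) z by apply: filterS fgK.
have [_ dE] := near_eq_diff idE did.
have dfg := congr1 (fun h => h v) (diff_comp dg df).
rewrite -[LHS]dfg dE.
exact: (etrans (esym (deriveE v did)) (derive_id _ _)).
Qed.

(** Partial derivatives become directional derivatives on the product space, where [schwarz] and the
    chain rule apply. *)
Lemma derive_fst U V W (f : U * V -> W) (x w : U) (y : V) :
  'D_w (fun z => f (z, y)) x = 'D_(w, 0) f (x, y).
Proof.
rewrite /derive; set q1 := fun _ => _; set q2 := fun _ => _.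
suff -> : q1 = q2 by [].
by apply/funext => h; rewrite /q1 /q2/= -[_ + (x, y)]/(_ + x, _ + y)/= scaler0 add0r.
Qed.

Lemma derive_snd U V W (f : U * V -> W) (x : U) (y w : V) :
  'D_w (fun z => f (x, z)) y = 'D_(0, w) f (x, y).
Proof.
rewrite /derive; set q1 := fun _ => _; set q2 := fun _ => _.
suff -> : q1 = q2 by [].
by apply/funext => h; rewrite /q1 /q2/= -[_ + (x, y)]/(_ + x, _ + y)/= scaler0 add0r.
Qed.

Lemma derive_swap U V W (f : U * V -> W) (p v : V * U) :
  'D_v (fun q => f (q.2, q.1)) p = 'D_(v.2, v.1) f (p.2, p.1).
Proof. by []. Qed.

Lemma differentiable_pairl U V (x : U) (y : V) :
  differentiable (fun z => (z, y)) x.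
Proof. exact: differentiable_pair. Qed.

Lemma differentiable_pairr U V (x : U) (y : V) :
  differentiable (fun z => (x, z)) y.
Proof. exact: differentiable_pair. Qed.

Lemma differentiable_swap U V (p : U * V) :
  differentiable (fun q => (q.2, q.1)) p.
Proof.
have lin : linear (fun q : U * V => (q.2, q.1)) by [].
pose sM := GRing.isLinear.Build _ _ _ _ _ lin.
pose s : {linear (U * V)%type -> (V * U)%type} := HB.pack (fun q : U * V => (q.2, q.1)) sM.
apply: (@linear_differentiable _ _ _ s) => q.
by apply: cvg_pair; [exact: cvg_snd|exact: cvg_fst].
Qed.

Lemma derive_pair U V W (f : U -> V) (g : U -> W) (x v : U) :
  differentiable f x -> differentiable g x ->
  'D_v (fun y => (f y, g y)) x = ('D_v f x, 'D_v g x).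
Proof.
move=> df dg; have dfg := differentiable_pair df dg.
by rewrite (deriveE v df) (deriveE v dg) (deriveE v dfg) (diff_pair df dg).
Qed.

Lemma cvg_map_snd U V W (f : V -> W) (x : U) (y : V) : differentiable f y ->
  (fun q : U * V => (q.1, f q.2)) @ (x, y) --> (x, f y).
Proof.
move=> df; have c1 : (fun q : U * V => q.1) @ (x, y) --> x by exact: cvg_fst.
have c2 : (fun q : U * V => f q.2) @ (x, y) --> f y.
  by apply: (cvg_comp _ _ cvg_snd); exact: differentiable_continuous df.
exact: (cvg_pair c1 c2).
Qed.

(** The consequence of class C^2 that fits [schwarz]: every first directional derivative is
    differentiable at the points of [A]. *)
Definition twice_differentiable V W (A : set V) (f : V -> W) :=
  forall p, A p -> differentiable f p /\ forall v, differentiable ('D_v f) p.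

Lemma of_class2_twice_differentiable V W (A : set V) (f : V -> W) :
  of_class 2 A f -> twice_differentiable A f.
Proof. by move=> [df ddf] p Ap; split=> [|v]; [exact: df|case: (ddf v) => +_; exact]. Qed.

End Calculus.

(** * Gradients and linear operators on R^n *)

Section Euclidean.
Context {R : realType} {n : nat}.
Local Notation E := 'cV[R]_n.

Lemma dotE (u v : E) : dot u v = \sum_i u i 0 * v i 0.
Proof. by rewrite /dot mxE; apply: eq_bigr => i _; rewrite mxE. Qed.

Lemma dotC (u v : E) : dot u v = dot v u.
Proof. by rewrite !dotE; apply: eq_bigr => i _; rewrite mulrC. Qed.

Lemma dotDr (w u v : E) : dot w (u + v) = dot w u + dot w v.
Proof. by rewrite /dot mulmxDr mxE. Qed.

Lemma dotr0 (w : E) : dot w 0 = 0.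
Proof. by rewrite /dot mulmx0 mxE. Qed.

Lemma dotNr (w u : E) : dot w (- u) = - dot w u.
Proof. by rewrite /dot mulmxN mxE. Qed.

Lemma dotZr (w u : E) (a : R) : dot w (a *: u) = a * dot w u.
Proof. by rewrite /dot -scalemxAr mxE. Qed.

Lemma dot_delta (i : 'I_n) (u : E) : dot (delta_mx i 0) u = u i 0.
Proof. by rewrite /dot trmx_delta -rowE mxE. Qed.

(** Gradients and Hessians are vectors while [schwarz] is about scalar functions; vector identities
    are proved by pairing with every [w]. *)
Lemma dot_ext (u v : E) : (forall w, dot w u = dot w v) -> u = v.
Proof. by move=> uv; apply/colP => i; rewrite -!dot_delta uv. Qed.

Lemma linear_of_dot (L : E -> E -> R) (f : E -> E) :
  (forall w a u v, L w (a *: u + v) = a * L w u + L w v) ->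
  (forall w u, dot w (f u) = L w u) -> linear f.
Proof.
by move=> lL fL a u v; apply: dot_ext => w; rewrite dotDr dotZr !fL.
Qed.

Lemma linear_opp_comp (f g : E -> E) :
  linear f -> linear g -> linear (fun u => - f (g u)).
Proof. by move=> lf lg a u v; rewrite lg lf opprD scalerN. Qed.

(** The basis vectors among the [w] give derivability of each coordinate, and [dot w] is a finite
    linear combination of coordinates. *)
Lemma derivable_dot (V : normedModType R) (G : V -> E) (x v : V) :
  (forall w, derivable (fun y => dot w (G y)) x v) ->
  forall w, dot w ('D_v G x) = 'D_v (fun y => dot w (G y)) x.
Proof.
move=> dG w.
have dGi i : derivable (fun y => G y i 0) x v.
  by rewrite (_ : (fun _ => _) = fun y => dot (delta_mx i 0) (G y))//;
     apply/funext => y; rewrite dot_delta.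
have dG' : derivable G x v by apply/derivable_mxP => i j; rewrite ord1.
rewrite (derive_mx dG') dotE.
have -> : (fun y => dot w (G y)) = \sum_(i < n) (w i 0 *: fun y => G y i 0).
  by apply/funext => y; rewrite dotE fct_sumE.
rewrite derive_sum; last by move=> i; exact/derivableZ/dGi.
by apply: eq_bigr => i _; rewrite mxE deriveZ.
Qed.

Lemma dot_grad (f : E -> R) (x w : E) :
  differentiable f x -> dot w (grad f x) = 'D_w f x.
Proof.
move=> df; rewrite (deriveE w df) dotE {2}[w]matrix_sum_delta linear_sum/=.
apply: eq_bigr => i _.
by rewrite big_ord1 linearZ/= mxE (deriveE _ df).
Qed.

Lemma operator_invK (f : E -> E) : bijective f -> cancel f (operator_inv f).
Proof.
move=> /bij_inj fi x; apply: pinvKV; last by rewrite inE.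
by move=> ? ? _ _; exact: fi.
Qed.

Lemma operator_invNK (f : E -> E) (u : E) :
  f (- u) = - f u -> bijective f -> operator_inv f (- f u) = - u.
Proof. by move=> <- bf; exact: operator_invK. Qed.

(** Finite dimension: an endomorphism of R^n with trivial kernel is invertible. *)
Lemma linear_inj_bij (f : E -> E) :
  linear f -> (forall u, f u = 0 -> u = 0) -> bijective f.
Proof.
move=> lf f0; pose fM := GRing.isLinear.Build _ _ _ _ _ lf.
pose F : {linear E -> E} := HB.pack f fM.
have kF : lker (linfun F) == 0%VS.
  apply/lker0P => u v; rewrite !lfunE/= => fuv; apply/eqP; rewrite -subr_eq0.
  by apply/eqP/f0; rewrite -[f]/(F : E -> E) linearB/= fuv subrr.
exists (linfun F)^-1%VF => u.
  by have := lker0_lfunK kF u; rewrite lfunE.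
by have := lker0_lfunVK kF u; rewrite lfunE.
Qed.

End Euclidean.

(** * Mixed derivatives of the cost *)

Section SmoothCost.
Context {R : realType} {n : nat}.
Local Notation E := 'cV[R]_n.
Variables (N : set (E * E)) (c : E -> E -> R).
Local Notation C := (fun p : E * E => c p.1 p.2).
Hypotheses (openN : open N) (C2 : twice_differentiable N C).

Lemma Dbar_DE (x xb w wb : E) :
  Dbar_D c x xb w wb = 'D_(0, wb) ('D_(w, 0) C) (x, xb).
Proof.
rewrite /Dbar_D -(derive_snd ('D_(w, 0) C)); congr ('D_wb _ xb).
by apply/funext => yb; rewrite -(derive_fst C).
Qed.

Lemma D_DbarE (x xb w wb : E) :
  D_Dbar c x xb w wb = 'D_(w, 0) ('D_(0, wb) C) (x, xb).
Proof.
rewrite /D_Dbar -(derive_fst ('D_(0, wb) C)); congr ('D_w _ x).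
by apply/funext => y; rewrite -(derive_snd C).
Qed.

Lemma near_slice1 (x xb : E) : N (x, xb) -> \forall y \near x, N (y, xb).
Proof.
move=> Nx; apply: (differentiable_continuous (differentiable_pairl x xb)).
exact: open_nbhs_nbhs.
Qed.

Lemma near_slice2 (x xb : E) : N (x, xb) -> \forall yb \near xb, N (x, yb).
Proof.
move=> Nx; apply: (differentiable_continuous (differentiable_pairr x xb)).
exact: open_nbhs_nbhs.
Qed.

Lemma differentiable_slice1 (x xb : E) :
  N (x, xb) -> differentiable (c ^~ xb) x.
Proof.
by move=> /C2[dC _]; exact: (differentiable_comp (differentiable_pairl x xb) dC).
Qed.

Lemma dot_grad_cost (x xb w : E) :
  N (x, xb) -> dot w (grad (c ^~ xb) x) = 'D_(w, 0) C (x, xb).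
Proof.
move=> Nx; rewrite dot_grad ?(derive_fst C)//; exact: differentiable_slice1.
Qed.

Lemma derivative2_sym (p a b : E * E) : N p -> 'D_b ('D_a C) p = 'D_a ('D_b C) p.
Proof.
move=> Np; have [_ ddC] := C2 Np.
have dC v : \forall q \near p, derivable C q v.
  apply: filterS (open_nbhs_nbhs (conj openN Np)) => q /C2[dC _].
  exact: diff_derivable.
exact: (schwarz (dC a) (dC b) (ddC a) (ddC b)).
Qed.

Lemma D_Dbar_sym (x xb w wb : E) :
  N (x, xb) -> D_Dbar c x xb w wb = Dbar_D c x xb w wb.
Proof. by move=> Nx; rewrite D_DbarE Dbar_DE; exact: derivative2_sym. Qed.

(** Pairing with [w] commutes with the derivative, and for [yb] near [xb] the paired gradient is
    ['D_(w, 0) C (x, yb)], since [N] is open. *)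
Lemma dot_Dbar_grad (x xb w wb : E) :
  N (x, xb) -> dot w (Dbar_grad c x xb wb) = Dbar_D c x xb w wb.
Proof.
move=> Nx; have [_ ddC] := C2 Nx.
have nE v : \forall yb \near xb,
    'D_(v, 0) C (x, yb) = dot v (grad (c ^~ yb) x).
  by apply: filterS (near_slice2 Nx) => yb Ny; rewrite dot_grad_cost.
rewrite derivable_dot => [|v].
  rewrite -(near_eq_derive _ (nE w)) (derive_snd ('D_(w, 0) C)).
  by rewrite Dbar_DE.
apply: near_eq_derivable (nE v) _.
apply: diff_derivable.
exact: (differentiable_comp (differentiable_pairr x xb) (ddC (v, 0))).
Qed.

Lemma dot_D_grad (x xb w xi : E) : N (x, xb) ->
  dot w ('D_xi (grad (c ^~ xb)) x) = 'D_(xi, 0) ('D_(w, 0) C) (x, xb).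
Proof.
move=> Nx; have [_ ddC] := C2 Nx.
have nE v : \forall y \near x,
    'D_(v, 0) C (y, xb) = dot v (grad (c ^~ xb) y).
  by apply: filterS (near_slice1 Nx) => y Ny; rewrite dot_grad_cost.
rewrite derivable_dot => [|v].
  by rewrite -(near_eq_derive _ (nE w)) (derive_fst ('D_(w, 0) C)).
apply: near_eq_derivable (nE v) _.
apply: diff_derivable.
exact: (differentiable_comp (differentiable_pairl x xb) (ddC (v, 0))).
Qed.

(** Paired with [w], the operator is the differential of ['D_(w, 0) C] at [(0, wb)]. *)
Lemma Dbar_grad_linear (x xb : E) : N (x, xb) -> linear (Dbar_grad c x xb).
Proof.
move=> Nx; have [_ /(_ (_, 0)) ddC] := C2 Nx.
pose L w wb := 'd ('D_(w, 0) C) (x, xb) (0, wb).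
refine (@linear_of_dot _ _ L _ _ _) => [w a u v|w wb]; rewrite /L.
  have -> : (0, a *: u + v) = a *: (0, u) + (0, v) :> E * E.
    by rewrite -[RHS]/(_ + _, _ + _)/= scaler0 addr0.
  by rewrite linearP.
by rewrite (dot_Dbar_grad _ _ Nx) Dbar_DE (deriveE (0, wb) (ddC w)).
Qed.

Lemma Dbar_gradN (x xb wb : E) :
  N (x, xb) -> Dbar_grad c x xb (- wb) = - Dbar_grad c x xb wb.
Proof.
move=> Nx; pose fM := GRing.isLinear.Build _ _ _ _ _ (Dbar_grad_linear Nx).
pose F : {linear E -> E} := HB.pack (Dbar_grad c x xb) fM.
exact: (linearN F wb).
Qed.

(** A vector of the kernel pairs to zero with every [xi], so the second half of (A2) makes it
    vanish. *)
Lemma Dbar_grad_bij (x xb : E) :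
  nondegenerate_pairing N c -> N (x, xb) -> bijective (Dbar_grad c x xb).
Proof.
move=> A2 Nx; apply: linear_inj_bij; first exact: Dbar_grad_linear.
move=> u u0; apply: (A2 _ _ Nx).2 => xi.
by rewrite -dot_Dbar_grad// u0 dotr0.
Qed.

End SmoothCost.

(** * The cost with its two variables exchanged *)

Section ExchangedCost.
Context {R : realType} {n : nat}.
Local Notation E := 'cV[R]_n.
Variables (N : set (E * E)) (c : E -> E -> R).
Local Notation C := (fun p : E * E => c p.1 p.2).

Lemma open_transpose : open N -> open (transpose N).
Proof.
move=> oN; apply: (open_comp _ oN) => p _.
exact/differentiable_continuous/differentiable_swap.
Qed.

Lemma twice_differentiable_cobar : twice_differentiable N C ->
  twice_differentiable (transpose N) (fun p => cobar c p.1 p.2).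
Proof.
move=> C2 p /C2[dC ddC]; split=> [|v].
  exact: (differentiable_comp (differentiable_swap p) dC).
have -> : 'D_v (fun p => cobar c p.1 p.2) =
    fun q => 'D_(v.2, v.1) C (q.2, q.1).
  by apply/funext => q; exact: (derive_swap C).
exact: (differentiable_comp (differentiable_swap p) (ddC (v.2, v.1))).
Qed.

Lemma nondegenerate_pairing_cobar : open N -> twice_differentiable N C ->
  nondegenerate_pairing N c -> nondegenerate_pairing (transpose N) (cobar c).
Proof.
move=> oN C2 A2 xb x Nx.
(* By conversion the left side is [D_Dbar c x xb w wb], so this is Schwarz for [c]; the two halves
   of nondegeneracy then trade places. *)
have sym w wb : Dbar_D (cobar c) xb x wb w = Dbar_D c x xb w wb.
  by rewrite -(D_Dbar_sym oN C2).
have [A21 A22] := A2 _ _ Nx; split=> [wb wb0|w w0].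
  by apply: A22 => w; rewrite -sym.
by apply: A21 => wb; rewrite -sym.
Qed.

End ExchangedCost.

(** * Potentials with a differentiable optimal map *)

Section OptimalPotential.
Context {R : realType} {n : nat}.
Local Notation E := 'cV[R]_n.
Variables (N : set (E * E)) (c : E -> E -> R).
Local Notation C := (fun p : E * E => c p.1 p.2).
Variables (Omega : set E) (phi : E -> R) (T : E -> E).
Hypotheses (openN : open N) (C2 : twice_differentiable N C).
Hypotheses (openO : open Omega)
  (dT : forall x, Omega x -> differentiable T x)
  (NT : forall x, Omega x -> N (x, T x))
  (optT : forall x y, Omega x -> N (y, T x) ->
     - c y (T x) - phi y <= - c x (T x) - phi x).

(** The quotient [h^-1 * D] lies between [- u] and [- v], both within [e] of [- d]. Multiplying by
    [|h|] makes the claim linear for either sign of [h]. *)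
Lemma sandwich_quotient (d e D h u v : R) : h != 0 ->
  - (h * u) <= D -> D <= - (h * v) ->
  `|u - d| <= e -> `|v - d| <= e -> `|- d - h^-1 * D| <= e.
Proof.
move=> h0 uD Dv ud vd; have h_gt0 : 0 < `|h| by rewrite normr_gt0.
rewrite -(ler_pM2l h_gt0) -normrM mulrBr mulrA mulfV// mul1r mulrN.
have : `|h * (u - d)| <= `|h| * e by rewrite normrM ler_pM2l.
have : `|h * (v - d)| <= `|h| * e by rewrite normrM ler_pM2l.
rewrite !ler_norml !mulrBr => /andP[? ?] /andP[? ?].
by apply/andP; split; lra.
Qed.

(** An envelope formula: continuity of [T] and of ['D_(v, 0) C] brings both bounds of the squeezed
    quotient to [- d]. *)
Lemma potential_derivable (x v : E) :
  Omega x -> is_derive x v phi (- 'D_(v, 0) C (x, T x)).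
Proof.
move=> Ox; set d := 'D_(v, 0) C (x, T x).
suff cvgd : (fun h : R => h^-1 *: ((phi \o shift x) (h *: v) - phi x)) @ 0^' --> - d.
  by apply: DeriveDef; [apply/cvg_ex; exists (- d)|exact/cvg_lim].
apply/cvgrPdist_le => e e0.
have Np := NT Ox; have [_ ddC] := C2 Np.
have good : \forall q \near (x, T x), N q /\ `|'D_(v, 0) C q - d| <= e.
  apply: filterI; first exact: open_nbhs_nbhs.
  have /differentiable_continuous/cvgrPdist_le/(_ _ e0) := ddC (v, 0).
  by apply: filterS => q; rewrite distrC.
(* The two base points vary independently, because the mean point in the first variable differs from
   the argument of [T]. *)
have goodT : \forall q \near (x, x), N (q.1, T q.2) /\
    `|'D_(v, 0) C (q.1, T q.2) - d| <= e.
  have cT := @cvg_map_snd _ _ _ _ _ x _ (dT Ox); exact: cT good.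
have [r1 r10 r1P] := near_ball0 goodT.
have [r2 r20 r2P] := near_ball0 (open_nbhs_nbhs (conj openO Ox)).
pose r := Num.min r1 r2; have r0 : 0 < r by rewrite lt_min r10.
suff : \forall h \near (0 : R), h != 0 ->
    `|- d - h^-1 * (phi (h *: v + x) - phi x)| <= e by [].
apply/nbhs_norm0P; exists (r / (`|v| + 1)) => [|h /=].
  by rewrite /= divr_gt0// ltr_wpDl.
rewrite ltr_pdivlMr ?ltr_wpDl// => hv h0; rewrite (addrC _ x).
have {}hv : `|h| * `|v| < r.
  by rewrite (le_lt_trans _ hv)// ler_wpM2l// lerDl.
have hv1 : `|h| * `|v| < r1 by rewrite (lt_le_trans hv)// ge_min lexx.
have Oy : Omega (x + h *: v).
  by apply: r2P; rewrite normrZ (lt_le_trans hv)// ge_min lexx orbT.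
have goodst s t : `|s| <= `|h| -> `|t| <= `|h| ->
    N (x + s *: v, T (x + t *: v)) /\
    `|'D_(v, 0) C (x + s *: v, T (x + t *: v)) - d| <= e.
  move=> sh th; apply: (r1P (s *: v, t *: v)).
  by rewrite prod_normE/= gt_max !normrZ !(le_lt_trans _ hv1)// ler_wpM2r.
have h00 : `|0 : R| <= `|h| by rewrite normr0.
have mvt t : `|t| <= `|h| -> exists2 s, `|s| <= `|h| &
    c (x + h *: v) (T (x + t *: v)) - c x (T (x + t *: v)) =
    h * 'D_(v, 0) C (x + s *: v, T (x + t *: v)).
  move=> th; have [s sh|s sh ->] :=
    @mvt_line _ _ (c ^~ (T (x + t *: v))) x v h.
    apply/diff_derivable/(differentiable_slice1 C2).
    by case: (goodst s t sh th).
  by exists s; [exact: sh|congr (h * _); exact: (derive_fst C)].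
(* Freezing the second variable at [T x] (parameter [0]) gives the lower bound of the increment of
   [phi], freezing it at [T (x + h *: v)] (parameter [h]) the upper one. *)
have [s1 sh1 E1] := mvt 0 h00; have [s2 sh2 E2] := mvt h (lexx _).
have [_ g1] := goodst _ _ sh1 h00; have [_ g2] := goodst _ _ sh2 (lexx _).
rewrite scale0r addr0 in E1 g1.
apply: (sandwich_quotient h0 _ _ g1 g2).
  rewrite -E1.
  have := @optT x (x + h *: v) Ox.
  have [+ _] := goodst h 0 (lexx _) h00; rewrite scale0r addr0 => Nh /(_ Nh).
  lra.
rewrite -E2.
have := @optT (x + h *: v) x Oy.
have [+ _] := goodst 0 h h00 (lexx _); rewrite scale0r addr0 => Nh /(_ Nh).
lra.
Qed.

Let graph (x : E) := (x, T x).

Lemma differentiable_graph (x : E) : Omega x -> differentiable graph x.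
Proof. by move=> Ox; apply: differentiable_pair => //; exact: dT. Qed.

Lemma derive_graph (x v : E) : Omega x -> 'D_v graph x = (v, 'd T x v).
Proof.
move=> Ox; rewrite (derive_pair v _ (dT Ox)) ?derive_id ?(deriveE v (dT Ox))//.
Qed.

Lemma near_Omega (x : E) : Omega x -> \forall y \near x, Omega y.
Proof. by move=> Ox; exact: open_nbhs_nbhs. Qed.

Lemma derive_potential (x v : E) :
  Omega x -> 'D_v phi x = - 'D_(v, 0) C (x, T x).
Proof. by move=> Ox; have [_ ->] := potential_derivable v Ox. Qed.

Lemma near_derive_potential (x w : E) : Omega x ->
  \forall y \near x, - 'D_(w, 0) C (graph y) = 'D_w phi y.
Proof.
by move=> Ox; apply: filterS (near_Omega Ox) => y Oy; rewrite derive_potential.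
Qed.

Lemma differentiable_cost_graph (x w : E) : Omega x ->
  differentiable (fun y => - 'D_(w, 0) C (graph y)) x.
Proof.
move=> Ox; have [_ ddC] := C2 (NT Ox).
apply: differentiableN.
exact: (differentiable_comp (differentiable_graph Ox) (ddC (w, 0))).
Qed.

Lemma derive_cost_graph (x w xi : E) : Omega x ->
  'D_xi (fun y => - 'D_(w, 0) C (graph y)) x =
  - 'D_(xi, 'd T x xi) ('D_(w, 0) C) (x, T x).
Proof.
move=> Ox; have [_ /(_ (w, 0)) ddC] := C2 (NT Ox).
have dcomp := differentiable_comp (differentiable_graph Ox) ddC.
transitivity (- 'D_xi ('D_(w, 0) C \o graph) x).
  exact: (deriveN (diff_derivable dcomp)).
by rewrite (derive_comp xi (differentiable_graph Ox) ddC) derive_graph.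
Qed.

Lemma dot_hess (x w xi : E) :
  Omega x -> dot w (hess phi x xi) = 'D_xi ('D_w phi) x.
Proof.
move=> Ox; rewrite /hess.
(* At this stage [phi] has directional derivatives only, so [dot_grad] is applied to the cost: on
   [Omega] the gradient of [phi] is minus that of [c] along the graph of [T]. *)
have gE v : \forall y \near x, - 'D_(v, 0) C (graph y) = dot v (grad phi y).
  apply: filterS (near_Omega Ox) => y Oy.
  rewrite -(dot_grad_cost C2 v (NT Oy)) -dotNr; congr dot.
  apply/colP => i; rewrite !mxE.
  by rewrite (derive_potential (delta_mx i 0) Oy) (derive_fst C).
rewrite derivable_dot => [|v].
  by rewrite -(near_eq_derive xi (gE w)) (near_eq_derive xi (near_derive_potential w Ox)).
apply: (near_eq_derivable (gE v)).
exact: diff_derivable (differentiable_cost_graph v Ox).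
Qed.

Lemma dot_chess (x w xi : E) : Omega x -> dot w (chess c phi x (T x) xi) =
  'D_(xi, 0) ('D_(w, 0) C) (x, T x) + 'D_xi ('D_w phi) x.
Proof.
move=> Ox; rewrite -(dot_D_grad openN C2 w xi (NT Ox)) -(dot_hess w xi Ox).
exact: (dotDr w ('D_xi (grad (c ^~ (T x))) x) (hess phi x xi)).
Qed.

(** The derivative of [- 'D_(w, 0) C (x, T x)] along [xi] splits by [(xi, 0) + (0, 'd T x xi)]; the
    first part cancels the cost term of [chess]. *)
Lemma chess_optimal_map (x xi : E) : Omega x ->
  chess c phi x (T x) xi = - Dbar_grad c x (T x) ('d T x xi).
Proof.
move=> Ox; have Np := NT Ox; apply: dot_ext => w; rewrite (dot_chess w xi Ox).
rewrite (dotNr w) (dot_Dbar_grad openN C2 w _ Np) Dbar_DE.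
rewrite -(near_eq_derive xi (near_derive_potential w Ox)).
rewrite (derive_cost_graph w xi Ox).
have [_ /(_ (w, 0)) ddC] := C2 Np.
rewrite (deriveE (xi, 0) ddC) (deriveE (0, 'd T x xi) ddC).
rewrite (deriveE (xi, 'd T x xi) ddC).
have -> : (xi, 'd T x xi) = (xi, 0) + (0, 'd T x xi) :> E * E.
  by rewrite -[RHS]/(_ + _, _ + _)/= addr0 add0r.
by rewrite linearD opprD addrA subrr add0r.
Qed.

(** Schwarz for [C] and for [phi]; the latter applies because near [x] each ['D_v phi] equals the
    differentiable function [- 'D_(v, 0) C (y, T y)]. *)
Lemma dot_chess_sym (x xi eta : E) : Omega x ->
  dot eta (chess c phi x (T x) xi) = dot xi (chess c phi x (T x) eta).
Proof.
move=> Ox; have Np := NT Ox.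
rewrite (dot_chess eta xi Ox) (dot_chess xi eta Ox).
have dphi v : \forall y \near x, derivable phi y v.
  by apply: filterS (near_Omega Ox) => y Oy; have [] := potential_derivable v Oy.
have ddphi v : differentiable ('D_v phi) x.
  exact: (near_eq_diff (near_derive_potential v Ox) (differentiable_cost_graph v Ox)).1.
exact: (f_equal2 +%R (derivative2_sym openN C2 (eta, 0) (xi, 0) Np)
  (schwarz (dphi eta) (dphi xi) (ddphi eta) (ddphi xi))).
Qed.

Lemma chess_linear (x : E) : Omega x -> linear (chess c phi x (T x)).
Proof.
move=> Ox.
have -> : chess c phi x (T x) = fun u => - Dbar_grad c x (T x) ('d T x u).
  by apply/funext => u; exact: chess_optimal_map.
apply: linear_opp_comp; first exact: (Dbar_grad_linear openN C2 (NT Ox)).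
by move=> a u v; rewrite linearP.
Qed.

(** * Mixed derivatives and Kim-McCann metric of the c-divergence *)

Local Notation DD := (cdivergence c phi T).

Lemma near_graph2 (x x' : E) : Omega x' -> N (x, T x') ->
  \forall y' \near x', N (x, T y').
Proof.
move=> Ox' Nx; have cT := differentiable_continuous (dT Ox').
exact: cT (near_slice2 openN Nx).
Qed.

(** The derivative in [x] leaves ['D_(w, 0) C (x, T x')] plus a term [k] constant in [x']; the chain
    rule does the rest. *)
Lemma Dbar_D_cdivergence (x x' w wb : E) : Omega x -> Omega x' ->
  N (x, T x') -> Dbar_D DD x x' w wb = Dbar_D c x (T x') w ('d T x' wb).
Proof.
move=> Ox Ox' Nx; rewrite (Dbar_DE c x (T x')); have [_ /(_ (w, 0)) ddC] := C2 Nx.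
pose g y' := (x, T y'); pose k := 'D_w phi x.
have dg : differentiable g x' by apply: differentiable_pair => //; exact: dT.
have gE : 'D_wb g x' = (0, 'd T x' wb).
  rewrite (derive_pair wb (differentiable_cst x x') (dT Ox')).
  by rewrite derive_cst (deriveE wb (dT Ox')).
have inner : \forall y' \near x',
    'D_(w, 0) C (g y') + k = 'D_w (fun y => DD y y') x.
  apply: filterS (near_graph2 Ox' Nx) => y' Ny'.
  have d1 := derivableP (diff_derivable (v := w) (differentiable_slice1 C2 Ny')).
  have [d2 _] := potential_derivable w Ox.
  have := is_deriveB (is_deriveB (is_deriveD d1 (derivableP d2))
    (is_derive_cst (c y' (T y')) x w)) (is_derive_cst (phi y') x w).
  by rewrite !subr0 (derive_fst C) => -[_ <-].
have dcomp := differentiable_comp dg ddC.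
rewrite -gE -(derive_comp wb dg ddC).
transitivity ('D_wb (fun y' => 'D_(w, 0) C (g y') + k) x').
  by rewrite (near_eq_derive wb inner).
have := is_deriveD (derivableP (diff_derivable (v := wb) dcomp)) (is_derive_cst k x' wb).
by rewrite addr0 => -[_ <-].
Qed.

(** Computed directly, since the derivative of [DD] in [x'] involves ['d T x'], whose
    differentiability is not assumed; the symmetry is taken from [C]. The terms in [x'] alone form
    the constant [k]. *)
Lemma D_Dbar_cdivergence (x x' w wb : E) : Omega x -> Omega x' ->
  N (x, T x') -> D_Dbar DD x x' w wb = Dbar_D c x (T x') w ('d T x' wb).
Proof.
move=> Ox Ox' Nx; rewrite -(D_Dbar_sym openN C2 w _ Nx) (D_DbarE c x (T x')).
have [_ /(_ (0, 'd T x' wb)) ddC] := C2 Nx.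
have [dCg _] := C2 (NT Ox').
pose k := 'D_wb (C \o graph) x' + 'D_wb phi x'.
have inner : \forall y \near x,
    'D_(0, 'd T x' wb) C (y, T x') - k = 'D_wb (DD y) x'.
  apply: filterS (near_slice1 openN Nx) => y /C2[dC _].
  pose g y' := (y, T y').
  have dg : differentiable g x' by apply: differentiable_pair => //; exact: dT.
  have gE : 'D_wb g x' = (0, 'd T x' wb).
    rewrite (derive_pair wb (differentiable_cst y x') (dT Ox')).
    by rewrite derive_cst (deriveE wb (dT Ox')).
  have d1 := derivableP (diff_derivable (v := wb) (differentiable_comp dg dC)).
  have d2 := derivableP (diff_derivable (v := wb)
    (differentiable_comp (differentiable_graph Ox') dCg)).
  have [d3 _] := potential_derivable wb Ox'.
  have := is_deriveB (is_deriveB (is_deriveD d1 (is_derive_cst (phi y) x' wb))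
    d2) (derivableP d3).
  rewrite addr0 (derive_comp wb dg dC) gE => -[_ dE].
  by rewrite /k opprD addrA -dE.
transitivity ('D_w (fun y => 'D_(0, 'd T x' wb) C (y, T x') - k) x).
  by rewrite (near_eq_derive w inner).
have dcomp := differentiable_comp (differentiable_pairl x (T x')) ddC.
have := is_deriveB (derivableP (diff_derivable (v := w) dcomp)) (is_derive_cst k x w).
by rewrite subr0 (derive_fst ('D_(0, 'd T x' wb) C)) => -[_ <-].
Qed.

Lemma kim_mccann_cdivergence (x x' : E) (xi eta : E * E) :
  Omega x -> Omega x' -> N (x, T x') ->
  kim_mccann DD x x' xi eta =
  - 2^-1 * (Dbar_D c x (T x') xi.1 ('d T x' eta.2)
    + Dbar_D c x (T x') eta.1 ('d T x' xi.2)).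
Proof.
move=> Ox Ox' Nx.
rewrite /kim_mccann (Dbar_D_cdivergence eta.1 xi.2 Ox Ox' Nx).
by rewrite (D_Dbar_cdivergence xi.1 eta.2 Ox Ox' Nx).
Qed.

Lemma Dbar_D_diag (x xi eta : E) : Omega x ->
  Dbar_D c x (T x) xi ('d T x eta) = - dot xi (chess c phi x (T x) eta).
Proof.
move=> Ox; rewrite (chess_optimal_map _ Ox) (dotNr xi) opprK.
by rewrite (dot_Dbar_grad openN C2 _ _ (NT Ox)).
Qed.

Lemma divergence_metric_chess (x : E) : Omega x ->
  divergence_metric DD x (chess c phi x (T x)).
Proof.
move=> Ox; split=> [|u v|xi]; first exact: chess_linear.
  by rewrite dotC dot_chess_sym.
rewrite (Dbar_D_cdivergence xi xi Ox Ox (NT Ox)).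
by rewrite (Dbar_D_diag xi xi Ox) opprK.
Qed.

End OptimalPotential.

(** * The dual optimal map *)

Section OptimalMap.
Context {R : realType} {n : nat}.
Local Notation E := 'cV[R]_n.
Variables (Omega Omegab : set E) (N : set (E * E)) (c : E -> E -> R).
Variable phi : E -> R.
Hypothesis T_defined : optimal_map_defined Omega Omegab N c phi.
Local Notation T := (optimal_map Omegab N c phi).
Local Notation m := (maximizer N c phi).

Lemma maximizers1 (xb : E) : Omegab xb -> maximizers N c phi xb = [set m xb].
Proof.
move=> /T_defined.1[x _ maxE]; rewrite maxE; congr [set _].
have : maximizers N c phi xb x by rewrite maxE.
by move=> /(xgetI 0); rewrite -/(m xb) maxE.
Qed.

Lemma optimal_mapK (x : E) : Omega x -> Omegab (T x) /\ m (T x) = x.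
Proof.
move=> Ox; have [_ [fm im sm]] := T_defined.
have OT : Omegab (T x).
  by apply: (surjpinv_image_sub (dflt := fun=> 0) sm); exists x.
by split => //; apply: (surjpK (fun=> 0) sm); rewrite inE.
Qed.

Lemma maximizerK (xb : E) : Omegab xb -> Omega (m xb) /\ T (m xb) = xb.
Proof.
move=> Oxb; have [_ [fm im sm]] := T_defined.
by split; [exact: fm|apply: pinvKV; rewrite ?inE].
Qed.

Lemma maximizers_optimal_map (x : E) : Omega x -> maximizers N c phi (T x) x.
Proof.
by move=> Ox; have [OTx mT] := optimal_mapK Ox; rewrite maximizers1//= mT.
Qed.

(** The supremum is attained, hence finite, so [fine] returns its true value. *)
Lemma conjugate_maximizer (xb x : E) : maximizers N c phi xb x ->
  conjugate N c phi xb = - c x xb - phi x.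
Proof.
move=> [Nx xmax]; rewrite /conjugate.
suff -> : ctransform N c (EFin \o phi) xb = (- c x xb - phi x)%:E by [].
apply/eqP; rewrite eq_le; apply/andP; split.
  apply: ge_ereal_sup => _ [y Ny <-] /=.
  by rewrite -EFinB lee_fin; exact: xmax.
by apply: ereal_sup_ubound; exists x => //=; rewrite EFinB.
Qed.

Hypotheses (N_sub : N `<=` Omega `*` Omegab) (openOb : open Omegab).
Local Notation phib := (conjugate N c phi).

(** The Fenchel-Young inequality [- c x yb - phi x <= phib yb] is an equality exactly when [x]
    maximizes for [yb], that is when [yb = T x]. *)
Lemma dual_maximizers (x : E) : Omega x ->
  maximizers (transpose N) (cobar c) phib x = [set T x].
Proof.
move=> Ox; have xmax := maximizers_optimal_map Ox.
have phibE := conjugate_maximizer xmax.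
have phib_ge yb : N (x, yb) -> - c x yb - phi x <= phib yb.
  move=> Nx; have [_ /= Oyb] := N_sub Nx.
  have : maximizers N c phi yb (m yb) by rewrite maximizers1.
  by move=> ymax; rewrite (conjugate_maximizer ymax); exact: ymax.2.
apply/seteqP; split => [xb [/= Nx xbmax]|_ ->].
  have [_ /= Oxb] := N_sub Nx.
  (* Testing the maximality of [xb] against [T x] gives [phib xb <= - c x xb - phi x], so [x]
     attains the supremum defining [phib xb]. *)
  suff : maximizers N c phi xb x.
    by rewrite maximizers1//= => xE; have [_] := maximizerK Oxb; rewrite -xE.
  split=> // y Ny.
  have := xbmax (T x) xmax.1; rewrite phibE /cobar => le1.
  have ymax : maximizers N c phi xb (m xb) by rewrite maximizers1.
  have := ymax.2 y Ny; rewrite -(conjugate_maximizer ymax) => le2.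
  lra.
split=> [|yb Ny]; first exact: xmax.1.
have := phib_ge yb Ny; rewrite phibE /cobar => le1.
lra.
Qed.

Lemma dual_maximizer (x : E) : Omega x ->
  maximizer (transpose N) (cobar c) phib x = T x.
Proof.
move=> Ox; rewrite /maximizer (dual_maximizers Ox).
by have := @xgetI _ 0 [set T x] (T x) erefl.
Qed.

Lemma dual_optimal_map_defined :
  optimal_map_defined Omegab Omega (transpose N) (cobar c) phib.
Proof.
split=> [x Ox|].
  exists (T x); last exact: dual_maximizers.
  by apply: open_nbhs_nbhs; split=> //; have [] := optimal_mapK Ox.
split=> [x Ox|x y|xb Oxb].
- by rewrite dual_maximizer//; have [] := optimal_mapK Ox.
- rewrite !inE => Ox Oy; rewrite !dual_maximizer// => Txy.
  by have [_ <-] := optimal_mapK Ox; have [_ <-] := optimal_mapK Oy; rewrite Txy.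
- have [Om Tm] := maximizerK Oxb.
  by exists (m xb) => //; rewrite dual_maximizer.
Qed.

End OptimalMap.

(** * Openness of the domain of the cost and proof of the theorem *)

(** Over [B], [N] is the preimage of [M] under the continuous map [(x, y) |-> (x, S y)]. It serves
    to deduce that [N] is open from the openness of [Nhat]. *)
Lemma open_of_pullback (R : realType) (U V W : normedModType R)
  (N : set (U * W)) (M : set (U * V)) (B : set W) (S : W -> V) :
  open B -> open M -> (forall y, B y -> differentiable S y) ->
  (forall p, N p <-> B p.2 /\ M (p.1, S p.2)) -> open N.
Proof.
move=> oB oM dS NE; rewrite openE => -[x y] /NE[/= By My]; rewrite /interior.
have nM : \forall q \near (x, y), M (q.1, S q.2).
  have cS := @cvg_map_snd _ _ _ _ _ x _ (dS _ By).
  exact: cS (open_nbhs_nbhs (conj oM My)).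
have nB : \forall q \near (x, y), B q.2.
  have c2 : (fun q : U * W => q.2) @ (x, y) --> y by exact: cvg_snd.
  exact: c2 (open_nbhs_nbhs (conj oB By)).
by apply: filterS2 nB nM => q Bq Mq; apply/NE.
Qed.

Theorem proposition12 (R : realType) (n : nat)
  (Omega Omegab : set 'cV[R]_n) (N : set ('cV[R]_n * 'cV[R]_n))
  (c : 'cV[R]_n -> 'cV[R]_n -> R) (phi phib : 'cV[R]_n -> R)
  (T Tb : 'cV[R]_n -> 'cV[R]_n) (Nhat : set ('cV[R]_n * 'cV[R]_n))
  (Omega_domain : domain Omega) (Omegab_domain : domain Omegab)
  (N_sub : N `<=` Omega `*` Omegab)
  (c_smooth : of_class 2 N (fun p => c p.1 p.2))
  (A1 : twisted N c) (A2 : nondegenerate_pairing N c)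
  (phi_convex : cconvex Omega N c phi)
  (T_defined : optimal_map_defined Omega Omegab N c phi)
  (phi_legendre : clegendre Omega Omegab N c phi)
  (T_def : T = optimal_map Omegab N c phi)
  (phib_def : phib = conjugate N c phi)
  (Tb_def : Tb = optimal_map Omega (transpose N) (cobar c) phib)
  (Nhat_def :
     Nhat = [set p | [/\ Omega p.1, Omega p.2 & N (p.1, T p.2)]])
  (Nhat_open : open Nhat) :
  [/\ (* the Kim-McCann metric of the c-divergence *)
      (forall x x' xi xi', Nhat (x, x') ->
         kim_mccann (cdivergence c phi T) x x' (xi, xi') (xi, xi') =
         - Dbar_D c x (T x') xi ('d T x' xi')),
      (* the differential of T *)
      (forall x', Omega x' ->
         bijective (Dbar_grad c x' (T x')) /\
         forall xi',
           chess c phi x' (T x') xi' +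
             Dbar_grad c x' (T x') ('d T x' xi') = 0 /\
           'd T x' xi' =
             - operator_inv (Dbar_grad c x' (T x'))
                 (chess c phi x' (T x') xi')),
      (* the restriction to the diagonal *)
      (forall x, Omega x ->
         [/\ Nhat (x, x),
             divergence_metric (cdivergence c phi T) x
               (chess c phi x (T x)) &
             forall xi eta,
               kim_mccann (cdivergence c phi T) x x (xi, xi) (eta, eta) =
               dot xi (chess c phi x (T x) eta)]),
      (* the dual optimal map *)
      optimal_map_defined Omegab Omega (transpose N) (cobar c) phib &
      (* the c-Crouzeix identity *)
      (forall x, Omega x ->
         [/\ forall eta, 'd T x ('d Tb (T x) eta) = eta,
             bijective (Dbar_grad (cobar c) (T x) x) &
             operator_inv (Dbar_grad c x (T x))
               \o chess c phi x (T x)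
               \o operator_inv (Dbar_grad (cobar c) (T x) x)
               \o chess (cobar c) phib (T x) x = id])].
Proof.
have [openO _ _] := Omega_domain; have [openOb _ _] := Omegab_domain.
have Tb_defined := dual_optimal_map_defined T_defined N_sub openOb.
rewrite -phib_def in Tb_defined.
have TP x : Omega x -> [/\ Omegab (T x), maximizers N c phi (T x) x & Tb (T x) = x].
  move=> Ox; have [OTx _] := optimal_mapK T_defined Ox; rewrite -T_def in OTx.
  split=> //; first by rewrite T_def; exact: (maximizers_optimal_map T_defined Ox).
  have [_] := maximizerK Tb_defined Ox.
  by rewrite phib_def (dual_maximizer T_defined N_sub Ox) -T_def -phib_def -Tb_def.
have TbP xb : Omegab xb -> [/\ Omega (Tb xb),
    maximizers (transpose N) (cobar c) phib (Tb xb) xb & T (Tb xb) = xb].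
  move=> Oxb; have [OTb mTb] := optimal_mapK Tb_defined Oxb.
  rewrite -Tb_def in OTb mTb.
  split=> //; first by rewrite Tb_def; exact: (maximizers_optimal_map Tb_defined Oxb).
  by rewrite -[RHS]mTb phib_def (dual_maximizer T_defined N_sub OTb) -T_def.
have [diffeoT _] := phi_legendre; rewrite -T_def in diffeoT.
have [g [gT _ [dT _] [dg _]]] := diffeoT.
(* The smooth inverse [g] and [Tb] agree on the open set [Omegab], which is enough to transfer
   differentiability. *)
have gTb xb : Omegab xb -> g xb = Tb xb.
  by move=> /TbP[OTb _ TTb]; rewrite -{1}TTb; have [_ ->] := gT _ OTb.
have dTb xb : Omegab xb -> differentiable Tb xb.
  move=> Oxb; apply: (near_eq_diff _ (dg _ Oxb)).1.
  by apply: filterS (open_nbhs_nbhs (conj openOb Oxb)) => yb /gTb.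
(* As [T (Tb xb) = xb] on [Omegab], [N] is the pullback of [Nhat] by [(x, xb) |-> (x, Tb xb)]. *)
have openN : open N.
  apply: (open_of_pullback openOb Nhat_open dTb) => -[x xb] /=.
  rewrite Nhat_def /=; split=> [Nx|[Oxb [_ _]]]; last first.
    by have [_ _ ->] := TbP _ Oxb.
  have [/= Ox Oxb] := N_sub _ Nx; have [OTb _ TTb] := TbP _ Oxb.
  by rewrite TTb.
have C2 := of_class2_twice_differentiable c_smooth.
have NT x : Omega x -> N (x, T x) by move=> /TP[_ [+ _] _].
have optT x y : Omega x -> N (y, T x) ->
    - c y (T x) - phi y <= - c x (T x) - phi x.
  by move=> /TP[_ [_ +] _]; exact.
have NTb xb : Omegab xb -> transpose N (xb, Tb xb) by move=> /TbP[_ [+ _] _].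
have optTb xb yb : Omegab xb -> transpose N (yb, Tb xb) ->
    - cobar c yb (Tb xb) - phib yb <= - cobar c xb (Tb xb) - phib xb.
  by move=> /TbP[_ [_ +] _]; exact.
have openN' := open_transpose openN.
have C2' := twice_differentiable_cobar C2.
have A2' := nondegenerate_pairing_cobar openN C2 A2.
have chessE x xi (Ox : Omega x) :=
  chess_optimal_map openN C2 openO dT NT optT xi Ox.
have chessbE xb xi (Oxb : Omegab xb) :=
  chess_optimal_map openN' C2' openOb dTb NTb optTb xi Oxb.
have bijD x (Ox : Omega x) := Dbar_grad_bij openN C2 A2 (NT _ Ox).
have bijDb xb (Oxb : Omegab xb) := Dbar_grad_bij openN' C2' A2' (NTb _ Oxb).
split.
- move=> x x' xi xi'; rewrite {1}Nhat_def => -[/= Ox Ox' Nx].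
  rewrite (kim_mccann_cdivergence openN C2 openO dT NT optT _ _ Ox Ox' Nx)/=.
  lra.
- move=> x' Ox'; have bD := bijD _ Ox'; split=> // xi'.
  rewrite (chessE _ xi' Ox') addNr; split=> //.
  by rewrite (operator_invNK (Dbar_gradN openN C2 _ (NT _ Ox')) bD) opprK.
- move=> x Ox; split.
  + by rewrite Nhat_def; split=> //; exact: NT.
  + exact: (divergence_metric_chess openN C2 openO dT NT optT).
  + move=> xi eta.
    rewrite (kim_mccann_cdivergence openN C2 openO dT NT optT _ _ Ox Ox (NT _ Ox))/=.
    rewrite !(Dbar_D_diag openN C2 openO dT NT optT _ _ Ox).
    rewrite (dot_chess_sym openN C2 openO dT NT optT xi eta Ox).
    lra.
- exact: Tb_defined.
- move=> x Ox; have [OTx _ TbT] := TP _ Ox.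
  have dTdTb eta : 'd T x ('d Tb (T x) eta) = eta.
    have TTb : \forall yb \near T x, T (Tb yb) = yb.
      by apply: filterS (open_nbhs_nbhs (conj openOb OTx)) => yb /TbP[_ _].
    exact: (diff_right_inverse eta TbT (dT _ Ox) (dTb _ OTx) TTb).
  have bDb := bijDb _ OTx; rewrite TbT in bDb.
  split=> //; apply/funext => eta /=.
  (* Evaluated from the right: the dual Hessian followed by the first inverse gives
     [- 'd Tb (T x) eta]; [chess] sends this to [Dbar_grad c x (T x) eta] by [dTdTb], and the last
     inverse returns [eta]. *)
  have := chessbE _ eta OTx; rewrite TbT => ->.
  have NTx : transpose N (T x, x) by exact: NT.
  have inv1 := operator_invNK (Dbar_gradN openN' C2' ('d Tb (T x) eta) NTx) bDb.
  have chess1 : chess c phi x (T x) (- 'd Tb (T x) eta) = Dbar_grad c x (T x) eta.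
    rewrite (chessE _ _ Ox) linearN/= dTdTb.
    by rewrite (Dbar_gradN openN C2 eta (NT _ Ox)) opprK.
  pose A := operator_inv (Dbar_grad c x (T x)).
  transitivity (A (chess c phi x (T x) (- 'd Tb (T x) eta))).
    exact: (congr1 (fun u => A (chess c phi x (T x) u)) inv1).
  exact: (etrans (congr1 A chess1) (operator_invK (bijD _ Ox) eta)).
Qed.
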